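(* Let $\mathfrak C$ be a left cancellative small category. The following are equivalent: (i) $I_l\,\bar\ltimes\,\Omega$ is effective; (ii) $\mathfrak C^{*,0}\,\bar\ltimes\,\Omega$ is effective; (iii) For all $\mathfrak v\in\mathfrak C^0$, $u\in\mathfrak v\mathfrak C^*\mathfrak v$ and $f_1,\dots,f_n\in\mathcal J$ with $f_i\subsetneq\mathfrak v\mathfrak C$ for all $1\le i\le n$: if $uz\in z\mathfrak C^*$ for all $z\in\mathfrak v\mathfrak C\setminus\bigcup_{i=1}^nf_i$, then $ux=x$ for all $x\in\mathfrak v\mathfrak C\setminus\bigcup_{i=1}^nf_i$.
   Context: $\mathfrak C$ denotes the set of morphisms, $\mathfrak C^0\subseteq\mathfrak C$ the identity morphisms (identified with objects), $\mathfrak d,\mathfrak t$ domain and target; $cd$ is defined iff $\mathfrak d(c)=\mathfrak t(d)$; left cancellative means $cx=cy\Rightarrow x=y$. For $S\subseteq\mathfrak C$, $cS=\{cs:s\in S,\mathfrak t(s)=\mathfrak d(c)\}$. $\mathfrak C^*$ is the set of invertible elements, $\mathfrak v\mathfrak C^*\mathfrak v$ the set of $u\in\mathfrak C^*$ with $\mathfrak t(u)=\mathfrak d(u)=\mathfrak v$, and $\mathfrak C^{*,0}=\{u\in\mathfrak C^*:\mathfrak t(u)=\mathfrak d(u)\}$. Each $c\in\mathfrak C$ gives the partial bijection $\mathfrak d(c)\mathfrak C\to c\mathfrak C$, $x\mapsto cx$, again denoted $c$; $I_l$ is the smallest semigroup of partial bijections of $\mathfrak C$ containing these and closed under inverses;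 $\mathcal J=\{\mathrm{dom}(s):s\in I_l\}$ is its semilattice of idempotents (product = intersection, order = inclusion). $\bar{\mathcal J}$ is the set of subsets $\varepsilon=e\setminus\bigcup_{i=1}^nf_i$ of $\mathfrak C$ with $e,f_1,\dots,f_n\in\mathcal J$, $f_i\subseteq e$. $\widehat{\mathcal J}$ is the space of non-zero multiplicative maps $\chi:\mathcal J\to\{0,1\}$ with $\chi(\emptyset)=0$ if $\emptyset\in\mathcal J$ (pointwise convergence). $\Omega\subseteq\widehat{\mathcal J}$ consists of those $\chi$ such that whenever $e=\bigcup_{i=1}^nf_i$ ($e,f_i\in\mathcal J$) and $\chi(e)=1$, then $\chi(f_i)=1$ for some $i$. For $\chi\in\Omega$ and $\varepsilon=e\setminus\bigcup f_i\in\bar{\mathcal J}$, put $\chi(\varepsilon)=1$ iff $\chi(e)=1$ and $\chi(f_i)=0$ for all $i$, and $\chi(\varepsilon)=0$ otherwise (well defined). $s\in I_l$ acts by $\chi\mapsto s.\chi=\chi(s^{-1}\cdot s)$ from $\Omega(s^{-1}s)=\{\chi\in\Omega:\chi(s^{-1}s)=1\}$ onto $\Omega(ss^{-1})$. $I_l\,\bar\ltimes\,\Omega$ is the groupoid of classes $[s,\chi]^{\bar\sim}$ with $s\in I_l$, $\chi\in\Omega(s^{-1}s)$, where $(s,\chi)\bar\sim(t,\psi)$ iff $\chi=\psi$ and there is $\varepsilon\in\bar{\mathcal J}$ with $\chi(\varepsilon)=1$ and $s\varepsilon=t\varepsilon$ (equality of restrictions to $\varepsilon$ as partial bijections); source $\chi$,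 range $s.\chi$, $[s,t.\chi]^{\bar\sim}[t,\chi]^{\bar\sim}=[st,\chi]^{\bar\sim}$; topology such that the sets $\{[s,\chi]^{\bar\sim}:\chi\in\Omega(s^{-1}s)\}$ are open and mapped homeomorphically onto $\Omega(s^{-1}s)$ by the source map. $\mathfrak C^{*,0}\,\bar\ltimes\,\Omega:=\{[u,\chi]^{\bar\sim}:u\in\mathfrak C^{*,0}\}$, an open subgroupoid. An étale groupoid $\mathcal G$ is effective if the interior of its isotropy subgroupoid equals $\mathcal G^{(0)}$. *)

(* Defs.v *)
From mathcomp Require Import all_boot.
From mathcomp Require Import all_classical topology.

Set Implicit Arguments.
Unset Strict Implicit.
Unset Printing Implicit Defensive.

Local Open Scope classical_set_scope.
Local Open Scope quotient_scope.

(* Groupoids with space of units [gobj], embedded in the space of arrows by   *)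
(* [gid]. [gmul g h] is the product gh; it is meaningful only when            *)
(* [gsrc g = grng h] and takes arbitrary values otherwise.                    *)
Record etaleGroupoid := EtaleGroupoid {
  gobj : topologicalType ;
  garr : topologicalType ;
  gsrc : garr -> gobj ;
  grng : garr -> gobj ;
  gid : gobj -> garr ;
  gmul : garr -> garr -> garr ;
  ginv : garr -> garr ;
  gsrc_id : forall x, gsrc (gid x) = x ;
  grng_id : forall x, grng (gid x) = x ;
  gsrc_mul : forall g h, gsrc g = grng h -> gsrc (gmul g h) = gsrc h ;
  grng_mul : forall g h, gsrc g = grng h -> grng (gmul g h) = grng g ;
  gmulA : forall g h k, gsrc g = grng h -> gsrc h = grng k ->
    gmul g (gmul h k) = gmul (gmul g h) k ;
  gmulg1 : forall g, gmul g (gid (gsrc g)) = g ;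
  gmul1g : forall g, gmul (gid (grng g)) g = g ;
  gsrc_inv : forall g, gsrc (ginv g) = grng g ;
  grng_inv : forall g, grng (ginv g) = gsrc g ;
  gmulgV : forall g, gmul g (ginv g) = gid (grng g) ;
  gmulVg : forall g, gmul (ginv g) g = gid (gsrc g) ;
  gsrc_continuous : continuous gsrc ;
  grng_continuous : continuous grng ;
  gid_continuous : continuous gid ;
  ginv_continuous : continuous ginv ;
  gmul_continuous : {within [set p : garr * garr | gsrc p.1 = grng p.2],
    continuous (fun p : garr * garr => gmul p.1 p.2)} ;
  gsrc_etale : forall g, exists U : set garr, [/\ open U, U g,
    forall h k, U h -> U k -> gsrc h = gsrc k -> h = k &
    forall V : set garr, V `<=` U -> open V -> open (gsrc @` V)]
}.

Definition isotropy (G : etaleGroupoid) : set (garr G) :=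
  [set g | gsrc g = grng g].

Definition effective (G : etaleGroupoid) : Prop :=
  (@isotropy G)° = range (@gid G).

Lemma set_type_continuous (X Y : topologicalType) (A : set Y)
    (f : X -> set_type A) : continuous (set_val \o f) -> continuous f.
Proof. exact: (@continuous_comp_initial (set_type A) X Y set_val f). Qed.

Lemma set_val_continuous (Y : topologicalType) (A : set Y) :
  continuous (set_val : set_type A -> Y).
Proof. exact: (@initial_continuous (set_type A) Y set_val). Qed.

Section OpenSubgroupoid.
Variables (G : etaleGroupoid) (H : set (garr G)).
Hypothesis H_open : open H.
Hypothesis H_id : forall x, H (gid x).
Hypothesis H_mul : forall g h, H g -> H h -> gsrc g = grng h -> H (gmul g h).
Hypothesis H_inv : forall g, H g -> H (ginv g).

Let arr : topologicalType := set_type H.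
Let val_ (g : arr) : garr G := set_val g.
Let arrP (g : arr) : H (val_ g). Proof. exact: set_mem (valP g). Qed.
Let mk g (Hg : H g) : arr := SigSub (mem_set Hg).
Let src (g : arr) := gsrc (val_ g).
Let rng (g : arr) := grng (val_ g).
Let one x : arr := mk (H_id x).
Let inv (g : arr) : arr := mk (H_inv (arrP g)).
Let mul (g h : arr) : arr :=
  if pselect (src g = rng h) is left gh then mk (H_mul (arrP g) (arrP h) gh)
  else g.

Let mulE g h : src g = rng h -> val_ (mul g h) = gmul (val_ g) (val_ h).
Proof. by rewrite /mul; case: pselect. Qed.

Let val_inj g h : val_ g = val_ h -> g = h.
Proof. exact: val_inj. Qed.

Let val_continuous : continuous val_.
Proof. exact: set_val_continuous. Qed.

Definition open_subgroupoid : etaleGroupoid.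
Proof.
apply: (@EtaleGroupoid (gobj G) arr src rng one mul inv).
- by move=> x; exact: gsrc_id.
- by move=> x; exact: grng_id.
- by move=> g h gh; rewrite /src mulE ?gsrc_mul.
- by move=> g h gh; rewrite /rng mulE ?grng_mul.
- move=> g h k gh hk; apply: val_inj; rewrite !mulE ?gmulA//.
    by rewrite /src mulE// gsrc_mul.
  by rewrite /rng mulE// grng_mul.
- by move=> g; apply: val_inj; rewrite mulE ?gmulg1// /rng grng_id.
- by move=> g; apply: val_inj; rewrite mulE ?gmul1g// /src gsrc_id.
- by move=> g; exact: gsrc_inv.
- by move=> g; exact: grng_inv.
- by move=> g; apply: val_inj; rewrite mulE ?gmulgV// /rng grng_inv.
- by move=> g; apply: val_inj; rewrite mulE ?gmulVg// /src gsrc_inv.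
- by move=> g; apply: continuous_comp; [exact: val_continuous|
    exact: gsrc_continuous].
- by move=> g; apply: continuous_comp; [exact: val_continuous|
    exact: grng_continuous].
- by apply: set_type_continuous => x; exact: gid_continuous.
- apply: set_type_continuous => g.
  apply: (@continuous_comp _ _ _ val_ (@ginv G)); first exact: val_continuous.
  exact: ginv_continuous.
- apply/subspace_continuousP => -[g h] /= gh W [/= B [[O oO <-] Ogh] BW].
  have /subspace_continuousP c := @gmul_continuous G.
  have /c/(_ O) : [set p : garr G * garr G | gsrc p.1 = grng p.2]
    (val_ g, val_ h) by [].
  have /[swap]/[apply] : nbhs (gmul (val_ g) (val_ h)) O.
    by rewrite -mulE//; exact: open_nbhs_nbhs.
  rewrite /within /= => -[[/= P Q] [/= Pg Qh] PQ].
  exists (val_ @^-1` P, val_ @^-1` Q) => /=.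
    by split; exact: val_continuous.
  move=> [g' h'] /= [Pg' Qh'] gh'; apply: BW => /=.
  rewrite -/(val_ (mul g' h')) mulE//.
  by apply: (PQ (val_ g', val_ h')).
- move=> g; have [U [oU Ug Uinj Uopen]] := gsrc_etale (val_ g).
  exists (val_ @^-1` U); split => //.
  + by move/continuousP: val_continuous; apply.
  + by move=> h k Uh Uk hk; apply: val_inj; exact: Uinj.
  + move=> V VU [O oO OV].
    have -> : src @` V = @gsrc G @` (O `&` H `&` U).
      apply/seteqP; split=> x /=.
        case=> h Vh <-; exists (val_ h) => //; split; last exact: VU.
        by split; [move: Vh; rewrite -OV | exact: arrP].
      case=> h [[Oh Hh] Uh] <-; exists (mk Hh) => //.
      by rewrite -OV.
    by apply: Uopen; [move=> ? [] | apply: openI => //; exact: openI].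
Defined.

End OpenSubgroupoid.

(* Small categories in single-sorted form: objects are identified with their  *)
(* identity morphisms. [ccomp c d] is the composite cd; it is meaningful only *)
(* when [cdom c = ctgt d] and takes arbitrary values otherwise.               *)
Record smallCategory := SmallCategory {
  mor :> Type ;
  cdom : mor -> mor ;
  ctgt : mor -> mor ;
  ccomp : mor -> mor -> mor ;
  cdom_dom : forall c, cdom (cdom c) = cdom c ;
  ctgt_dom : forall c, ctgt (cdom c) = cdom c ;
  cdom_tgt : forall c, cdom (ctgt c) = ctgt c ;
  ctgt_tgt : forall c, ctgt (ctgt c) = ctgt c ;
  cdom_comp : forall c d, cdom c = ctgt d -> cdom (ccomp c d) = cdom d ;
  ctgt_comp : forall c d, cdom c = ctgt d -> ctgt (ccomp c d) = ctgt c ;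
  ccompA : forall b c d, cdom b = ctgt c -> cdom c = ctgt d ->
    ccomp b (ccomp c d) = ccomp (ccomp b c) d ;
  ccomp1 : forall c, ccomp c (cdom c) = c ;
  ccomp1l : forall c, ccomp (ctgt c) c = c
}.

Definition left_cancellative (C : smallCategory) :=
  forall c x y : C, cdom c = ctgt x -> cdom c = ctgt y ->
    ccomp c x = ccomp c y -> x = y.

Record lcCategory := LcCategory {
  lc_cat :> smallCategory ;
  lc_cancel : left_cancellative lc_cat
}.

Section Category.
Variable C : smallCategory.
Implicit Types (c u v : C) (S : set C).

Definition identities : set C := [set v | cdom v = v].

Definition lmulset c S : set C :=
  [set x | exists s, [/\ S s, ctgt s = cdom c & x = ccomp c s]].

Definition is_inverse c d :=
  [/\ cdom c = ctgt d, cdom d = ctgt c,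
      ccomp c d = ctgt c & ccomp d c = ctgt d].

Definition invertibles : set C := [set c | exists d, is_inverse c d].

Definition invertibles_at v : set C :=
  [set u | [/\ invertibles u, ctgt u = v & cdom u = v]].

Definition invertible_endos : set C :=
  [set u | invertibles u /\ ctgt u = cdom u].

End Category.

Arguments identities C : clear implicits.
Arguments invertibles C : clear implicits.
Arguments invertibles_at C v : clear implicits.
Arguments invertible_endos C : clear implicits.

(* Partial bijections of a type, as functional and injective graphs.          *)
Record pbij (T : Type) := PBij {
  pgraph :> T -> T -> Prop ;
  pgraph_fun : forall x y z, pgraph x y -> pgraph x z -> y = z ;
  pgraph_inj : forall x y z, pgraph x z -> pgraph y z -> x = y
}.

Section PartialBijections.
Variable T : Type.
Implicit Types s t : pbij T.

Lemma pbij_eq s t : (forall x y, s x y <-> t x y) -> s = t.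
Proof.
case: s t => [s s1 s2] [t t1 t2] /= st.
have e : s = t by apply/funext => x; apply/funext => y; exact/propext.
by subst t; congr PBij; exact: Prop_irrelevance.
Qed.

Definition pdom s : set T := [set x | exists y, s x y].

Lemma pinv_fun s x y z : s y x -> s z x -> y = z.
Proof. exact: pgraph_inj. Qed.

Lemma pinv_inj s x y z : s z x -> s z y -> x = y.
Proof. exact: pgraph_fun. Qed.

Definition pinv s : pbij T :=
  @PBij T (fun x y => s y x) (@pinv_fun s) (@pinv_inj s).

Lemma pcomp_fun s t x y z : (exists2 w, t x w & s w y) ->
  (exists2 w, t x w & s w z) -> y = z.
Proof.
by case=> w tw sy [w' tw' sz]; rewrite -(pgraph_fun tw tw') in sz;
  exact: pgraph_fun sy sz.
Qed.

Lemma pcomp_inj s t x y z : (exists2 w, t x w & s w z) ->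
  (exists2 w, t y w & s w z) -> x = y.
Proof.
by case=> w tw sy [w' tw' sz]; rewrite -(pgraph_inj sy sz) in tw';
  exact: pgraph_inj tw tw'.
Qed.

Definition pcomp s t : pbij T :=
  @PBij T (fun x z => exists2 y, t x y & s y z) (@pcomp_fun s t) (@pcomp_inj s t).

Lemma prestrict_fun s (A : set T) x y z :
  A x /\ s x y -> A x /\ s x z -> y = z.
Proof. by case=> _ sy [_]; exact: pgraph_fun. Qed.

Lemma prestrict_inj s (A : set T) x y z :
  A x /\ s x z -> A y /\ s y z -> x = y.
Proof. by case=> _ sy [_]; exact: pgraph_inj. Qed.

Definition prestrict s (A : set T) : pbij T :=
  @PBij T (fun x y => A x /\ s x y) (@prestrict_fun s A) (@prestrict_inj s A).

Definition ppreimage s (A : set T) : set T :=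
  [set x | exists2 y, s x y & A y].

End PartialBijections.

Section Hull.
Variable C : lcCategory.

Lemma lmul_fun (c x y z : C) : ctgt x = cdom c /\ y = ccomp c x ->
  ctgt x = cdom c /\ z = ccomp c x -> y = z.
Proof. by case=> _ -> [_ ->]. Qed.

Lemma lmul_inj (c x y z : C) : ctgt x = cdom c /\ z = ccomp c x ->
  ctgt y = cdom c /\ z = ccomp c y -> x = y.
Proof. by case=> tx -> [ty]; apply: lc_cancel. Qed.

Definition lmul (c : C) : pbij C :=
  @PBij C (fun x y => ctgt x = cdom c /\ y = ccomp c x)
    (@lmul_fun c) (@lmul_inj c).

(* I_l: the semigroup generated by the maps x |-> cx and their inverses.      *)
Inductive left_inverse_hull : set (pbij C) :=
| hull_lmul c : left_inverse_hull (lmul c)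
| hull_inv s : left_inverse_hull s -> left_inverse_hull (pinv s)
| hull_comp s t : left_inverse_hull s -> left_inverse_hull t ->
    left_inverse_hull (pcomp s t).

Definition Il : Type := {classic set_type left_inverse_hull}.

Definition Il_pbij (s : Il) : pbij C := set_val s.
Coercion Il_pbij : Il >-> pbij.

Definition Il_of s (hs : left_inverse_hull s) : Il := SigSub (mem_set hs).

Lemma IlP (s : Il) : left_inverse_hull s.
Proof. exact: set_mem (valP s). Qed.

Definition Il_lmul c : Il := Il_of (hull_lmul c).
Definition Il_inv (s : Il) : Il := Il_of (hull_inv (IlP s)).
Definition Il_comp (s t : Il) : Il := Il_of (hull_comp (IlP s) (IlP t)).

(* The semilattice of idempotents, each identified with its domain.           *)
Definition constructible : set (set C) := @pdom C @` left_inverse_hull.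

Definition J : Type := set_type constructible.

Definition J_set (e : J) : set C := set_val e.
Coercion J_set : J >-> set.

Definition J_of A (hA : constructible A) : J := SigSub (mem_set hA).

Lemma JP (e : J) : constructible e.
Proof. exact: set_mem (valP e). Qed.

Lemma J_eq (e f : J) : J_set e = J_set f -> e = f.
Proof. exact: val_inj. Qed.

Lemma constructible_dom (s : Il) : constructible (pdom s).
Proof. by exists s => //; exact: IlP. Qed.

Lemma constructible_preimage (s : Il) (e : J) : constructible (ppreimage s e).
Proof.
have [t tI te] := JP e.
exists (pcomp t s); first exact: hull_comp tI (IlP s).
rewrite -te; apply/seteqP; split=> x /=.
  by case=> z [y sxy tyz]; exists y => //; exists z.
by case=> y sxy [z tyz]; exists z, y.
Qed.

Lemma constructibleI (e f : J) : constructible (J_set e `&` J_set f).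
Proof.
have [s sI se] := JP e; have [t tI tf] := JP f.
exists (pcomp t (pcomp (pinv s) s)).
  exact: hull_comp tI (hull_comp (hull_inv sI) sI).
rewrite -se -tf; apply/seteqP; split=> x /=.
  case=> z [y [w sxw syw] tyz]; rewrite /= in syw.
  by rewrite (pgraph_inj sxw syw); split; [exists w | exists z].
by case=> -[w sxw] [z txz]; exists z, x => //; exists w.
Qed.

Definition J_dom (s : Il) : J := J_of (constructible_dom s).
Definition J_preimage (s : Il) (e : J) : J := J_of (constructible_preimage s e).
Definition J_meet (e f : J) : J := J_of (constructibleI e f).

(* {0,1}^J with the topology of pointwise convergence                         *)
Definition J_maps : topologicalType := {ptws J -> bool}.

Definition J_characters : set J_maps :=
  [set chi : J_maps | [/\ exists e, chi e = true,
    forall e f, chi (J_meet e f) = chi e && chi f &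
    forall e, J_set e = set0 -> chi e = false]].

Definition Omega_set : set J_maps :=
  [set chi : J_maps | J_characters chi /\
    forall (e : J) (n : nat) (f : 'I_n -> J),
      J_set e = \bigcup_i J_set (f i) -> chi e = true ->
      exists i, chi (f i) = true].

(* A subtype carries the subspace topology.                                   *)
Definition Omega : Type := set_type Omega_set.

Definition Omega_val (chi : Omega) : J -> bool := set_val chi.
Coercion Omega_val : Omega >-> Funclass.

Definition Omega_of chi (h : Omega_set chi) : Omega := SigSub (mem_set h).

Lemma OmegaP (chi : Omega) : Omega_set (chi : J_maps).
Proof. exact: set_mem (valP chi). Qed.

Lemma Omega_eq (chi psi : Omega) :
  (forall e, chi e = psi e) -> chi = psi.
Proof. by move=> h; apply: val_inj; apply/funext. Qed.

(* Omega(s^-1 s), as s^-1 s is the idempotent with domain that of s.          *)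
Definition Omega_dom (s : Il) : set Omega :=
  [set chi : Omega | chi (J_dom s) = true].

Section OmegaTheory.
Implicit Types (chi : Omega) (e f : J) (s t : Il).

Lemma Omega_ext chi e f : J_set e = J_set f -> chi e = chi f.
Proof. by move=> /J_eq ->. Qed.

Lemma Omega_ex chi : exists e, chi e = true.
Proof. by have [[]] := OmegaP chi. Qed.

Lemma OmegaI chi e f : chi (J_meet e f) = chi e && chi f.
Proof. by have [[_ + _] _] := OmegaP chi; apply. Qed.

Lemma Omega0 chi e : J_set e = set0 -> chi e = false.
Proof. by have [[_ _ +] _] := OmegaP chi; apply. Qed.

Lemma OmegaU chi e n (f : 'I_n -> J) :
  J_set e = \bigcup_i J_set (f i) -> chi e = true ->
  exists i, chi (f i) = true.
Proof. by have [_ +] := OmegaP chi; apply. Qed.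

Lemma Omega_le chi e f : J_set e `<=` J_set f -> chi e = true -> chi f = true.
Proof.
move=> ef ce; have : chi (J_meet e f) = chi e.
  by apply: Omega_ext; exact/setIidPl.
by rewrite OmegaI ce.
Qed.

Lemma Omega_act_subproof s chi : Omega_dom s chi ->
  Omega_set ((fun e => chi (J_preimage s e)) : J_maps).
Proof.
move=> cs; split; first split.
- exists (J_dom (Il_inv s)); move: cs; apply: Omega_le.
  by move=> x [y sxy]; exists y => //; exists x.
- move=> e f; rewrite -OmegaI; apply: Omega_ext => /=.
  apply/seteqP; split=> x /=.
    by case=> y sxy [ey fy]; split; exists y.
  case=> -[y sxy ey] [z sxz fz]; exists y => //; split=> //.
  by rewrite (pgraph_fun sxy sxz).
- move=> e e0; apply: Omega0 => /=; apply/seteqP; split=> x //=.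
  by case=> y _; rewrite e0.
- move=> e n f ef; apply: (@OmegaU chi _ n (fun i => J_preimage s (f i))).
  apply/seteqP; split=> x /=.
    by case=> y sxy; rewrite ef => -[i _ fy]; exists i => //; exists y.
  by case=> i _ [y sxy fy]; exists y => //; rewrite ef; exists i.
Qed.

Definition OmegaD s : topologicalType := set_type (Omega_dom s).

Definition OmegaD_val s (x : OmegaD s) : Omega := set_val x.

Lemma OmegaDP s (x : OmegaD s) : Omega_dom s (OmegaD_val x).
Proof. exact: set_mem (valP x). Qed.

Definition OmegaD_of s chi (h : Omega_dom s chi) : OmegaD s :=
  SigSub (mem_set h).

Lemma OmegaD_ofK s chi (h : Omega_dom s chi) : OmegaD_val (OmegaD_of h) = chi.
Proof. by []. Qed.

(* s^-1 e s is the idempotent with domain the preimage of e under s           *)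
Definition Omega_act s (x : OmegaD s) : Omega :=
  Omega_of (Omega_act_subproof (OmegaDP x)).

Lemma Omega_actE s (x : OmegaD s) e :
  Omega_act x e = OmegaD_val x (J_preimage s e).
Proof. by []. Qed.

Lemma Omega_act_dom s (x : OmegaD s) : Omega_dom (Il_inv s) (Omega_act x).
Proof.
have := OmegaDP x; apply: Omega_le.
by move=> z [y sxy]; exists y => //; exists z.
Qed.

Lemma Omega_actK s (x : OmegaD s) :
  Omega_act (OmegaD_of (Omega_act_dom x)) = OmegaD_val x.
Proof.
apply: Omega_eq => e; rewrite Omega_actE OmegaD_ofK Omega_actE.
rewrite -[RHS]andTb -(OmegaDP x) -OmegaI.
apply: Omega_ext; apply/seteqP; split=> z /=.
  case=> y szy [w] swy ew; rewrite /= in swy; rewrite (pgraph_inj szy swy).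
  by split=> //; exists y.
by case=> -[y szy] ez; exists y => //; exists z.
Qed.

Lemma Omega_comp_dom s t (x : OmegaD s) (y : OmegaD t) :
  OmegaD_val x = Omega_act y -> Omega_dom (Il_comp s t) (OmegaD_val y).
Proof.
move=> xy; have := OmegaDP x; rewrite /Omega_dom /= xy Omega_actE.
apply: Omega_le => z.
by case=> w tzw [v swv]; exists v, w.
Qed.

Lemma Omega_act_comp s t (x : OmegaD s) (y : OmegaD t)
    (xy : OmegaD_val x = Omega_act y) :
  Omega_act (OmegaD_of (Omega_comp_dom xy)) = Omega_act x.
Proof.
apply: Omega_eq => e; rewrite !Omega_actE OmegaD_ofK xy Omega_actE.
apply: Omega_ext; apply/seteqP; split=> z /=.
  by case=> w [v tzv svw] ew; exists v => //; exists w.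
by case=> v tzv [w svw ew]; exists w => //; exists v.
Qed.

End OmegaTheory.

Definition Jbar : set (set C) :=
  [set eps | exists (e : J) (n : nat) (f : 'I_n -> J),
    (forall i, J_set (f i) `<=` J_set e) /\
    eps = J_set e `\` \bigcup_i J_set (f i)].

(* [Omega_bar chi eps] is chi(eps) = 1, see Omega_barP for the independence   *)
(* of the presentation of eps.                                                *)
Definition Omega_bar (chi : Omega) (eps : set C) :=
  exists (e : J) (n : nat) (f : 'I_n -> J),
    [/\ forall i, J_set (f i) `<=` J_set e,
        eps = J_set e `\` \bigcup_i J_set (f i),
        chi e = true & forall i, chi (f i) = false].

Lemma Omega_bar_Jbar (chi : Omega) eps : Omega_bar chi eps -> Jbar eps.
Proof. by case=> e [n [f [fe -> _ _]]]; exists e, n, f. Qed.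

Lemma Omega_barP (chi : Omega) (e : J) n (f : 'I_n -> J) :
  (forall i, J_set (f i) `<=` J_set e) ->
  Omega_bar chi (J_set e `\` \bigcup_i J_set (f i)) <->
  chi e = true /\ forall i, chi (f i) = false.
Proof.
move=> fe; split; last by case=> ce cf; exists e, n, f.
case=> e' [m [f' [fe' eE ce' cf']]].
have ce : chi e = true.
  pose g (i : 'I_m.+1) := if unlift ord0 i is Some j then f' j else J_meet e' e.
  have [|i] := @OmegaU chi e' m.+1 g _ ce'.
    apply/seteqP; split=> x.
      move=> e'x; have [[j _ fx]|nf] := pselect ((\bigcup_i J_set (f' i)) x).
        by exists (lift ord0 j) => //; rewrite /g liftK.
      have : (J_set e `\` \bigcup_i J_set (f i)) x by rewrite eE.
      by case=> ex _; exists ord0 => //; rewrite /g unlift_none.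
    case=> i _; rewrite /g; case: unliftP => [j|] _; first exact: fe'.
    by case.
  rewrite /g; case: unliftP => [j|] _; first by rewrite cf'.
  by rewrite OmegaI => /andP[].
split=> // i; apply/negP => ci.
have [|| j] := @OmegaU chi (J_meet e' (f i)) m (fun j => J_meet (f i) (f' j)).
- apply/seteqP; split=> x /=.
    case=> e'x fx; have [[j _ f'x]|nf] := pselect ((\bigcup_i J_set (f' i)) x).
      by exists j.
    have : (J_set e `\` \bigcup_i J_set (f i)) x by rewrite eE.
    by case=> _ []; exists i.
  by case=> j _ [fx f'x]; split=> //; exact: fe' f'x.
- by rewrite OmegaI ce' ci.
- by rewrite OmegaI cf' andbF.
Qed.

Lemma Omega_barE (chi : Omega) (e : J) : chi e = true -> Omega_bar chi (J_set e).
Proof.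
have -> : J_set e = J_set e `\` \bigcup_(i : 'I_0) J_set e.
  by rewrite (_ : \bigcup__ _ = set0) ?setD0//; apply/seteqP; split=> x // [[]].
by move=> ce; exists e, 0, (fun=> e); split=> //; case.
Qed.

Lemma Omega_barI chi eps del :
  Omega_bar chi eps -> Omega_bar chi del -> Omega_bar chi (eps `&` del).
Proof.
move=> [e [n [f [fe -> ce cf]]]] [e' [m [f' [fe' -> ce' cf']]]].
pose g (i : 'I_(n + m)) := J_meet (J_meet e e')
  (match fintype.split i with inl j => f j | inr j => f' j end).
exists (J_meet e e'), (n + m), g; split.
- by move=> i; apply: subIsetl.
- apply/seteqP; split=> x /=.
    case=> -[ex nf] [e'x nf']; split=> // -[i _ [_]].
    by case: (fintype.split i) => j fx; [apply: nf | apply: nf']; exists j.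
  case=> -[ex e'x] ng; split; split=> // -[j _ fx]; apply: ng.
    exists (lshift m j) => //; split=> //.
    by have := unsplitK (inl j : 'I_n + 'I_m); rewrite /= => ->.
  exists (rshift n j) => //; split=> //.
  by have := unsplitK (inr j : 'I_n + 'I_m); rewrite /= => ->.
- by rewrite OmegaI ce ce'.
- move=> i; rewrite OmegaI.
  by case: (fintype.split i) => j; rewrite ?cf ?cf' andbF.
Qed.

Lemma Omega_barS (chi : Omega) (e : J) eps :
  Omega_bar chi eps -> eps `<=` J_set e -> chi e = true.
Proof.
move=> [d [n [f [fd -> cd cf]]]] de.
pose g (i : 'I_n.+1) := if unlift ord0 i is Some j then f j else J_meet d e.
have [|i] := @OmegaU chi d n.+1 g _ cd.
  apply/seteqP; split=> x.
    move=> dx; have [[j _ fx]|nf] := pselect ((\bigcup_i J_set (f i)) x).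
      by exists (lift ord0 j) => //; rewrite /g liftK.
    by exists ord0 => //; rewrite /g unlift_none; split=> //; apply: de; split.
  case=> i _; rewrite /g; case: unliftP => [j|] _; first exact: fd.
  by case.
rewrite /g; case: unliftP => [j|] _; first by rewrite cf.
by rewrite OmegaI => /andP[].
Qed.

Lemma Omega_bar_preimage s (x : OmegaD s) eps :
  Omega_bar (Omega_act x) eps -> Omega_bar (OmegaD_val x) (ppreimage s eps).
Proof.
move=> [e [n [f [fe -> ce cf]]]].
exists (J_preimage s e), n, (fun i => J_preimage s (f i)); split=> //.
  by move=> i z [y szy fy]; exists y => //; exact: fe fy.
apply/seteqP; split=> z /=.
  case=> y szy [ey nf]; split; first by exists y.
  by case=> i _ [w szw fw]; apply: nf; exists i; rewrite ?(pgraph_fun szy szw).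
case=> -[y szy ey] nf; exists y => //; split=> // -[i _ fy].
by apply: nf; exists i => //; exists y.
Qed.

(* Pairs (s, chi) with chi in Omega(s^-1 s), topologised as the disjoint      *)
(* union over s of the spaces Omega(s^-1 s).                                  *)
Definition germ_pair : topologicalType := {s : Il & OmegaD s}.

Definition gp_fun (a : germ_pair) : Il := projT1 a.
Definition gp_dom (a : germ_pair) : OmegaD (gp_fun a) := projT2 a.
Definition gp_src (a : germ_pair) : Omega := OmegaD_val (gp_dom a).

Definition germ_eq (a b : germ_pair) : Prop :=
  gp_src a = gp_src b /\
  exists eps, [/\ Jbar eps, Omega_bar (gp_src a) eps &
                  prestrict (gp_fun a) eps = prestrict (gp_fun b) eps].

Definition germ_eqb (a b : germ_pair) : bool := `[< germ_eq a b >].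

Lemma germ_eqb_refl : reflexive germ_eqb.
Proof.
move=> a; apply/asboolP; split=> //.
have h := Omega_barE (OmegaDP (gp_dom a)).
by exists (J_set (J_dom (gp_fun a))); split=> //; exact: Omega_bar_Jbar h.
Qed.

Lemma germ_eqb_sym : symmetric germ_eqb.
Proof.
suff h a b : germ_eq a b -> germ_eq b a.
  by move=> a b; apply/asboolP/asboolP; exact: h.
by case=> ab [eps [h1 h2 h3]]; split=> //; exists eps; rewrite -ab.
Qed.

Lemma germ_eqb_trans : transitive germ_eqb.
Proof.
move=> b a c /asboolP[ab [eps [_ h2 h3]]] /asboolP[bc [del [_ k2 k3]]].
apply/asboolP; split; first by rewrite ab.
have h : Omega_bar (gp_src a) (eps `&` del).
  by apply: Omega_barI => //; rewrite ab.
exists (eps `&` del); split=> //; first exact: Omega_bar_Jbar h.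
have rE (s : pbij C) (A : set C) x y : A x -> s x y <-> prestrict s A x y.
  by move=> Ax; split=> [|[]].
apply: pbij_eq => x y; split=> -[[ex dx] sxy]; split=> //.
  by apply/(rE _ _ _ _ dx); rewrite -k3; split=> //;
     apply/(rE _ _ _ _ ex); rewrite -h3.
by apply/(rE _ _ _ _ ex); rewrite h3; split=> //;
   apply/(rE _ _ _ _ dx); rewrite k3.
Qed.

Canonical germ_equiv := EquivRel germ_eqb
  germ_eqb_refl germ_eqb_sym germ_eqb_trans.

(* The classes [s, chi] with the quotient topology: a set W of classes is     *)
(* open iff {chi | [s, chi] \in W} is open in Omega(s^-1 s) for every s. This *)
(* is the topology for which each slice {[s, chi] | chi} is open and mapped   *)
(* homeomorphically onto Omega(s^-1 s) by the source map, see                 *)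
(* [germ_mk_open], [germ_src_continuous] and [germ_src_etale].                *)
Definition germ : topologicalType := quotient_topology {eq_quot germ_equiv}.

(* [germ_mk x] is the class [s, chi], for x the point chi of Omega(s^-1 s).   *)
Definition germ_mk s (x : OmegaD s) : germ := \pi_germ (existT _ s x).

Lemma germ_mkP (P : germ -> Prop) :
  (forall s (x : OmegaD s), P (germ_mk x)) -> forall g, P g.
Proof. by move=> h g; rewrite -[g]reprK; case: (repr g) => s x; exact: h. Qed.

Lemma germ_mk_eq s t (x : OmegaD s) (y : OmegaD t) :
  germ_mk x = germ_mk y <->
  OmegaD_val x = OmegaD_val y /\ exists eps,
    [/\ Jbar eps, Omega_bar (OmegaD_val x) eps & prestrict s eps = prestrict t eps].
Proof.
have E := @eqquotP _ _ {eq_quot germ_equiv} (existT _ s x) (existT _ t y).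
by split=> [/E/asboolP|H] //; apply/E/asboolP.
Qed.

Lemma germ_mk_eqJ s t (x : OmegaD s) (y : OmegaD t) (e : J) :
  OmegaD_val x = OmegaD_val y -> OmegaD_val x e = true ->
  (forall a b, J_set e a -> s a b <-> t a b) ->
  germ_mk x = germ_mk y.
Proof.
move=> xy xe st; apply/germ_mk_eq; split=> //; exists (J_set e).
have h := Omega_barE xe; split=> //; first exact: Omega_bar_Jbar h.
by apply: pbij_eq => a b; split=> -[ea sab]; split=> //; apply/(st _ _ ea).
Qed.

Definition germ_src (g : germ) : Omega := gp_src (repr g).
Definition germ_rng (g : germ) : Omega := Omega_act (gp_dom (repr g)).

Definition germ_inv (g : germ) : germ :=
  germ_mk (OmegaD_of (Omega_act_dom (gp_dom (repr g)))).

(* [s, t.chi][t, chi] = [st, chi], see [germ_mulE].                           *)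
Definition germ_mul (g h : germ) : germ :=
  if pselect (germ_src g = germ_rng h) is left gh
  then germ_mk (OmegaD_of (Omega_comp_dom gh)) else g.

Lemma germ_reprP s (x : OmegaD s) : exists t (y : OmegaD t),
  repr (germ_mk x) = existT _ t y /\ germ_mk y = germ_mk x.
Proof.
have := reprK (germ_mk x); case: (repr (germ_mk x)) => t y yx.
by exists t, y.
Qed.

Lemma germ_srcE s (x : OmegaD s) : germ_src (germ_mk x) = OmegaD_val x.
Proof.
by rewrite /germ_src; have [t [y [-> /germ_mk_eq[]]]] := germ_reprP x.
Qed.

Lemma germ_mk_act s t (x : OmegaD s) (y : OmegaD t) :
  germ_mk x = germ_mk y -> Omega_act x = Omega_act y.
Proof.
suff h s' t' (x' : OmegaD s') (y' : OmegaD t') e : germ_mk x' = germ_mk y' ->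
    Omega_act x' e = true -> Omega_act y' e = true.
  by move=> xy; apply: Omega_eq => e; apply/idP/idP; apply: h.
case/germ_mk_eq => xy [eps [_ xeps st]]; rewrite !Omega_actE => xe.
apply: (@Omega_barS _ _ (eps `&` J_set (J_preimage s' e))).
  by rewrite -xy; apply: Omega_barI => //; exact: Omega_barE.
move=> a [epa [b sab eb]]; exists b => //.
by have [] : prestrict t' eps a b by rewrite -st.
Qed.

Lemma germ_rngE s (x : OmegaD s) : germ_rng (germ_mk x) = Omega_act x.
Proof.
by rewrite /germ_rng; have [t [y [-> /germ_mk_act]]] := germ_reprP x.
Qed.

Lemma germ_invE s (x : OmegaD s) :
  germ_inv (germ_mk x) = germ_mk (OmegaD_of (Omega_act_dom x)).
Proof.
rewrite /germ_inv; have [t [y [-> /= yx]]] := germ_reprP x; have ac := germ_mk_act yx.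
have [xy [eps [_ yeps ts]]] := (germ_mk_eq y x).1 yx.
apply/germ_mk_eq; rewrite !OmegaD_ofK; split=> //.
have h : Omega_bar (Omega_act y) (ppreimage (Il_inv t) eps).
  have := @Omega_bar_preimage _ (OmegaD_of (Omega_act_dom y)) eps.
  by rewrite Omega_actK OmegaD_ofK; apply.
exists (ppreimage (Il_inv t) eps); split=> //; first exact: Omega_bar_Jbar h.
have E a b : eps a -> Il_pbij t a b <-> Il_pbij s a b.
  move=> ea; split=> ab.
    by have [] : prestrict s eps a b by rewrite -ts.
  by have [] : prestrict t eps a b by rewrite ts.
apply: pbij_eq => a b; split=> -[[c tca ec] /= ba]; rewrite /= in tca;
  split; try (by exists c).
  by apply/E => //; rewrite (pgraph_inj ba tca).
have sca : Il_pbij s c a by apply/E.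
by apply/E => //; rewrite (pgraph_inj ba sca).
Qed.

Lemma germ_mulE s t (x : OmegaD s) (y : OmegaD t)
    (xy : OmegaD_val x = Omega_act y) :
  germ_mul (germ_mk x) (germ_mk y) = germ_mk (OmegaD_of (Omega_comp_dom xy)).
Proof.
rewrite /germ_mul; case: pselect; last by rewrite germ_srcE germ_rngE.
rewrite /germ_src /germ_rng /gp_src.
have [s' [x' [-> /germ_mk_eq[xx [eps [_ xeps ss]]]]]] := germ_reprP x.
have [t' [y' [-> /germ_mk_eq[yy [del [_ ydel tt]]]]]] := germ_reprP y.
move=> xy'.
have acy : Omega_act y' = Omega_act y.
  by rewrite -xy -xx; exact: esym xy'.
apply/germ_mk_eq; rewrite !OmegaD_ofK; split=> //.
have h : Omega_bar (OmegaD_val y') (del `&` ppreimage t' eps).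
  by apply: Omega_barI => //; apply: Omega_bar_preimage; rewrite acy -xy -xx.
exists (del `&` ppreimage t' eps); split=> //; first exact: Omega_bar_Jbar h.
have Et a b : del a -> Il_pbij t' a b <-> Il_pbij t a b.
  move=> ea; split=> ab.
    by have [] : prestrict t del a b by rewrite -tt.
  by have [] : prestrict t' del a b by rewrite tt.
have Es a b : eps a -> Il_pbij s' a b <-> Il_pbij s a b.
  move=> ea; split=> ab.
    by have [] : prestrict s eps a b by rewrite -ss.
  by have [] : prestrict s' eps a b by rewrite ss.
apply: pbij_eq => a b; split=> -[[da [c tac ec]] [d tad sdb]]; split=> //.
- by split=> //; exists c.
- exists c; first by apply/Et.
  by apply/Es => //; rewrite (pgraph_fun tac tad).
- by split=> //; exists c.
- exists c => //; apply/Es => //.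
  by have tac' := (Et _ _ da).1 tac; rewrite (pgraph_fun tac' tad).
Qed.

Lemma Il_idem_ex (e : J) :
  exists s : Il, forall a b, Il_pbij s a b <-> J_set e a /\ a = b.
Proof.
have [s sI se] := JP e.
exists (Il_of (hull_comp (hull_inv sI) sI)) => a b; rewrite -se /=; split.
  by case=> c sac sbc; split; [exists c | exact: pgraph_inj sac sbc].
by case=> -[c sac] <-; exists c.
Qed.

Definition Il_idem (e : J) : Il := projT1 (cid (Il_idem_ex e)).

Lemma Il_idemE (e : J) a b : Il_pbij (Il_idem e) a b <-> J_set e a /\ a = b.
Proof. exact: (projT2 (cid (Il_idem_ex e))). Qed.

Lemma Omega_dom_idem chi (e : J) :
  Omega_val chi e = true -> Omega_dom (Il_idem e) chi.
Proof. by apply: Omega_le => a ea; exists a; apply/Il_idemE. Qed.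

(* The unit [e, chi]; it does not depend on the choice of e, see [germ_idE].  *)
Definition germ_id (chi : Omega) : germ :=
  germ_mk (OmegaD_of (Omega_dom_idem (projT2 (cid (Omega_ex chi))))).

Lemma germ_idE s (x : OmegaD s) : (forall a b, Il_pbij s a b -> a = b) ->
  germ_id (OmegaD_val x) = germ_mk x.
Proof.
move=> s1; rewrite /germ_id; case: cid => e /= xe.
apply: (@germ_mk_eqJ _ _ _ _ (J_meet e (J_dom s))) => //.
  by rewrite OmegaI xe (OmegaDP x).
move=> a b [ea [c sac]]; have ac := s1 _ _ sac; subst c; split.
  by move=> /Il_idemE[_ <-].
by move=> sab; apply/Il_idemE; split=> //; exact: s1 sab.
Qed.

Lemma germ_src_id chi : germ_src (germ_id chi) = chi.
Proof. by rewrite germ_srcE. Qed.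

Lemma germ_rng_id chi : germ_rng (germ_id chi) = chi.
Proof.
rewrite germ_rngE; case: cid => e /= ce; apply: Omega_eq => f.
rewrite Omega_actE OmegaD_ofK -[RHS]andTb -ce -OmegaI.
apply: Omega_ext; apply/seteqP; split=> a /=.
  by case=> b /Il_idemE[ea <-].
by case=> ea fa; exists a => //; apply/Il_idemE.
Qed.

Lemma germ_src_mul g h :
  germ_src g = germ_rng h -> germ_src (germ_mul g h) = germ_src h.
Proof.
elim/germ_mkP: g => s x; elim/germ_mkP: h => t y.
by rewrite germ_srcE germ_rngE => xy; rewrite germ_mulE !germ_srcE.
Qed.

Lemma germ_rng_mul g h :
  germ_src g = germ_rng h -> germ_rng (germ_mul g h) = germ_rng g.
Proof.
elim/germ_mkP: g => s x; elim/germ_mkP: h => t y.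
rewrite germ_srcE germ_rngE => xy.
by rewrite germ_mulE !germ_rngE Omega_act_comp.
Qed.

Lemma germ_mulA g h k : germ_src g = germ_rng h -> germ_src h = germ_rng k ->
  germ_mul g (germ_mul h k) = germ_mul (germ_mul g h) k.
Proof.
elim/germ_mkP: g => s x; elim/germ_mkP: h => t y; elim/germ_mkP: k => u z.
rewrite !germ_srcE !germ_rngE => xy yz.
have xyz : OmegaD_val x = Omega_act (OmegaD_of (Omega_comp_dom yz)).
  by rewrite Omega_act_comp.
have yxz : OmegaD_val (OmegaD_of (Omega_comp_dom xy)) = Omega_act z by [].
rewrite !germ_mulE.
apply: (@germ_mk_eqJ _ _ _ _ (J_dom u)) => //; first exact: OmegaDP.
move=> a b _ /=; split.
  by case=> c [d uad tdc] scb; exists d => //; exists c.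
by case=> c uac [d tcd sdb]; exists d => //; exists c.
Qed.

Lemma germ_mulg1 g : germ_mul g (germ_id (germ_src g)) = g.
Proof.
elim/germ_mkP: g => s x; rewrite germ_srcE.
have h := Omega_dom_idem (OmegaDP x).
have ix : germ_id (OmegaD_val x) = germ_mk (OmegaD_of h).
  by apply: (@germ_idE _ (OmegaD_of h)) => a b /Il_idemE[].
have xy : OmegaD_val x = Omega_act (OmegaD_of h).
  by rewrite -germ_rngE -ix germ_rng_id.
rewrite ix germ_mulE; apply: (@germ_mk_eqJ _ _ _ _ (J_dom s)) => //.
  exact: OmegaDP.
move=> a b /= da; split; first by case=> c /Il_idemE[_ <-].
by move=> sab; exists a => //; apply/Il_idemE.
Qed.

Lemma germ_mul1g g : germ_mul (germ_id (germ_rng g)) g = g.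
Proof.
elim/germ_mkP: g => s x; rewrite germ_rngE.
have h := Omega_dom_idem (Omega_act_dom x).
have ix : germ_id (Omega_act x) = germ_mk (OmegaD_of h).
  by apply: (@germ_idE _ (OmegaD_of h)) => a b /Il_idemE[].
rewrite ix germ_mulE; apply: (@germ_mk_eqJ _ _ _ _ (J_dom s)) => //.
  exact: OmegaDP.
move=> a b /= da; split; first by case=> c sac /Il_idemE[_ <-].
by move=> sab; exists b => //; apply/Il_idemE; split=> //; exists a.
Qed.

Lemma germ_src_inv g : germ_src (germ_inv g) = germ_rng g.
Proof. by elim/germ_mkP: g => s x; rewrite germ_invE germ_srcE germ_rngE. Qed.

Lemma germ_rng_inv g : germ_rng (germ_inv g) = germ_src g.
Proof.
by elim/germ_mkP: g => s x; rewrite germ_invE germ_srcE germ_rngE Omega_actK.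
Qed.

Lemma germ_mulgV g : germ_mul g (germ_inv g) = germ_id (germ_rng g).
Proof.
elim/germ_mkP: g => s x; rewrite germ_invE.
have xy := esym (Omega_actK x).
rewrite germ_mulE -germ_idE ?germ_rngE//.
by move=> a b /= [c]; exact: pgraph_fun.
Qed.

Lemma germ_mulVg g : germ_mul (germ_inv g) g = germ_id (germ_src g).
Proof.
elim/germ_mkP: g => s x; rewrite germ_invE germ_mulE -germ_idE ?germ_srcE//.
by move=> a b /= [c]; exact: pgraph_inj.
Qed.

Lemma Omega_eval_continuous (e : J) :
  continuous (fun chi : Omega => Omega_val chi e).
Proof.
move=> chi; apply: (@continuous_comp _ _ _ (set_val : Omega -> J_maps)
  (fun f : J_maps => f e)); first exact: set_val_continuous.
have h : nbhs (set_val chi : J_maps) --> (set_val chi : J_maps) by exact: cvg_id.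
move/cvg_sup: h => /(_ e) h A; rewrite /= nbhsE => -[B [oB Bc] BA].
apply: (@filterS _ _ _ ((fun f : J_maps => f e) @^-1` B)).
  by move=> f; exact: BA.
by apply: h; exists ((fun f : J_maps => f e) @^-1` B) => //; split => //; exists B.
Qed.

Lemma Omega_continuous (X : topologicalType) (f : X -> Omega) :
  (forall e : J, continuous (fun x => Omega_val (f x) e)) -> continuous f.
Proof.
move=> fc; apply: set_type_continuous => x; apply/cvg_sup => e.
move: x; apply/(@continuousP _ (initial_topology (fun g : J -> bool => g e))).
by move=> A [B ? <-]; move/continuousP: (fc e); apply.
Qed.

Lemma Omega_eval_open (e : J) (b : bool) :
  open [set chi : Omega | Omega_val chi e = b].
Proof.
by have /continuousP/(_ [set b]) := @Omega_eval_continuous e; apply;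
  exact: discrete_open.
Qed.

Lemma Omega_bar_open eps : open [set chi | Omega_bar chi eps].
Proof.
rewrite openE => chi [e [n [f [fe epsE ce cf]]]].
have h1 : \forall psi \near chi, Omega_val psi e = true.
  by apply: open_nbhs_nbhs; split=> //; exact: Omega_eval_open.
have h2 : \forall psi \near chi, forall i, Omega_val psi (f i) = false.
  apply: (@filter_forall _ 'I_n (fun i => [set psi : Omega | Omega_val psi (f i) = false])
    _ (nbhs_filter chi)) => i.
  apply: open_nbhs_nbhs; split; last exact: cf.
  exact: Omega_eval_open.
by apply: filterS2 h1 h2 => psi pe pf; exists e, n, f.
Qed.

Lemma OmegaD_val_continuous s : continuous (@OmegaD_val s).
Proof. exact: set_val_continuous. Qed.

Lemma Omega_act_continuous s : continuous (@Omega_act s).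
Proof.
apply: Omega_continuous => e x.
apply: (@continuous_comp _ _ _ (@OmegaD_val s)
  (fun chi => Omega_val chi (J_preimage s e))).
  exact: OmegaD_val_continuous.
exact: Omega_eval_continuous.
Qed.

Lemma germ_openP (W : set germ) :
  open W <-> forall s, open (@germ_mk s @^-1` W).
Proof. exact: (@sigT_openP _ (fun s : Il => OmegaD s) (\pi_germ @^-1` W)). Qed.

Lemma germ_mk_continuous s : continuous (@germ_mk s).
Proof. by apply/continuousP => W /germ_openP. Qed.

Lemma germ_continuous (X : topologicalType) (f : germ -> X) :
  (forall s, continuous (f \o @germ_mk s)) -> continuous f.
Proof.
move=> fc; apply/continuousP => A oA; apply/germ_openP => s.
by move/continuousP: (fc s) => /(_ A oA).
Qed.

Lemma germ_mk_open s (U : set (OmegaD s)) : open U -> open (@germ_mk s @` U).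
Proof.
case=> O oO OU; apply/germ_openP => t.
rewrite openE => y [x Ux /germ_mk_eq[xy [eps [_ xeps st]]]].
pose N : set Omega := O `&` [set chi | Omega_bar chi eps].
have oN : open N by apply: openI => //; exact: Omega_bar_open.
have : nbhs y (@OmegaD_val t @^-1` N).
  apply: OmegaD_val_continuous; apply: open_nbhs_nbhs; split=> //.
  by rewrite -xy; split=> //; move: Ux; rewrite -OU.
apply: filterS => z [Oz zeps].
have h : Omega_dom s (OmegaD_val z).
  apply: (@Omega_barS _ _ (eps `&` pdom t)).
    by apply: Omega_barI => //; exact: Omega_barE (OmegaDP z).
  move=> a [ea [b tab]]; exists b.
  by have [] : prestrict s eps a b by rewrite st.
exists (OmegaD_of h); first by rewrite -OU.
apply/germ_mk_eq; rewrite OmegaD_ofK; split=> //.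
by exists eps; split=> //; exact: Omega_bar_Jbar zeps.
Qed.

Lemma germ_mk_nbhs s (x : OmegaD s) : nbhs (germ_mk x) (range (@germ_mk s)).
Proof.
apply: (@open_nbhs_nbhs germ); split; last by exists x.
by apply: germ_mk_open; exact: openT.
Qed.

Lemma germ_src_continuous : continuous germ_src.
Proof.
apply: germ_continuous => s.
rewrite (_ : _ \o _ = @OmegaD_val s); first exact: OmegaD_val_continuous.
by apply/funext => x /=; rewrite germ_srcE.
Qed.

Lemma germ_rng_continuous : continuous germ_rng.
Proof.
apply: germ_continuous => s.
rewrite (_ : _ \o _ = @Omega_act s); first exact: Omega_act_continuous.
by apply/funext => x /=; rewrite germ_rngE.
Qed.

Lemma germ_inv_continuous : continuous germ_inv.
Proof.
apply: germ_continuous => s.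
rewrite (_ : _ \o _ = @germ_mk (Il_inv s) \o
  (fun x : OmegaD s => OmegaD_of (Omega_act_dom x))); last first.
  by apply/funext => x /=; rewrite germ_invE.
move=> x; apply: continuous_comp; last exact: germ_mk_continuous.
by move: x; apply: set_type_continuous; exact: Omega_act_continuous.
Qed.

(* If nearby g is of the form [s, f(x)], continuity at x reduces to that of f *)
Lemma germ_mk_cvg (X : topologicalType) (F : set_system X) (f : X -> Omega)
    (g : X -> germ) s (a : OmegaD s) {FF : Filter F} :
  f @ F --> OmegaD_val a ->
  (\forall x \near F, exists2 h : Omega_dom s (f x), True &
     g x = germ_mk (OmegaD_of h)) ->
  g @ F --> germ_mk a.
Proof.
move=> fa gE W /germ_mk_continuous [B [[O oO OB] Ba] BW].
have : F (f @^-1` O).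
  by apply: fa; apply: open_nbhs_nbhs; split=> //; move: Ba; rewrite -OB.
apply: filterS2 gE => x [h _ gx] Ofx; rewrite /= gx.
by apply: (BW (OmegaD_of h)); rewrite -OB.
Qed.

Lemma germ_id_continuous : continuous germ_id.
Proof.
move=> chi; have [e ce] := Omega_ex chi; have h := Omega_dom_idem ce.
have E psi (k : Omega_dom (Il_idem e) psi) : germ_id psi = germ_mk (OmegaD_of k).
  by apply: (@germ_idE _ (OmegaD_of k)) => a b /Il_idemE[].
rewrite /continuous_at (E _ h).
apply: (@germ_mk_cvg _ (nbhs chi) id _ _ (OmegaD_of h) (nbhs_filter chi)); first exact: cvg_id.
have : nbhs chi [set psi : Omega | Omega_val psi e = true].
  by apply: open_nbhs_nbhs; split=> //; exact: Omega_eval_open.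
by apply: filterS => psi pe; exists (Omega_dom_idem pe) => //; exact: E.
Qed.

Lemma germ_mul_continuous :
  {within [set p : germ * germ | germ_src p.1 = germ_rng p.2],
    continuous (fun p : germ * germ => germ_mul p.1 p.2)}.
Proof.
apply/subspace_continuousP => -[g h] /=.
elim/germ_mkP: g => s x; elim/germ_mkP: h => t y.
rewrite germ_srcE germ_rngE => xy; rewrite /from_subspace /= (germ_mulE xy).
pose N := [set p : germ * germ |
  range (@germ_mk s) p.1 /\ range (@germ_mk t) p.2].
have nN : nbhs (germ_mk x, germ_mk y) N.
  exists (range (@germ_mk s), range (@germ_mk t)) => //=.
  by split; exact: germ_mk_nbhs.
apply: (@germ_mk_cvg _ _ (fun p : germ * germ => germ_src p.2) _ _
  (OmegaD_of (Omega_comp_dom xy)) (within_filter _ (nbhs_filter _))).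
  apply: cvg_within_filter.
  rewrite OmegaD_ofK -germ_srcE.
  have c : continuous (fun p : germ * germ => germ_src p.2).
    move=> p; apply: (@continuous_comp _ _ _ snd germ_src); first exact: cvg_snd.
    exact: germ_src_continuous.
  exact: (c (germ_mk x, germ_mk y)).
rewrite near_withinE; apply: filterS nN => -[g h] [/= [x' _ <-] [y' _ <-]].
rewrite !germ_srcE germ_rngE => xy'.
by exists (Omega_comp_dom xy') => //; rewrite germ_mulE.
Qed.

Lemma germ_src_etale g : exists U : set germ, [/\ open U, U g,
  forall h k, U h -> U k -> germ_src h = germ_src k -> h = k &
  forall V : set germ, V `<=` U -> open V -> open (germ_src @` V)].
Proof.
elim/germ_mkP: g => s x; exists (range (@germ_mk s)); split.
- by apply: germ_mk_open; exact: openT.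
- by exists x.
- move=> _ _ [y _ <-] [z _ <-]; rewrite !germ_srcE => yz; congr germ_mk.
  exact: val_inj.
- move=> V Vs /germ_openP/(_ s)[O oO OV].
  have -> : germ_src @` V = O `&` Omega_dom s.
    apply/seteqP; split=> chi /=.
      case=> g Vg <-; have [y _ gy] := Vs _ Vg; rewrite -gy germ_srcE.
      split; last exact: OmegaDP.
      have : (@germ_mk s @^-1` V) y by rewrite /= gy.
      by rewrite -OV.
    case=> Oc sc; exists (germ_mk (OmegaD_of sc)); last by rewrite germ_srcE.
    suff : (@germ_mk s @^-1` V) (OmegaD_of sc) by [].
    by rewrite -OV.
  by apply: openI => //; exact: Omega_eval_open.
Qed.

(* The groupoid of classes [s, chi] with s in I_l.                            *)
Definition hull_groupoid : etaleGroupoid :=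
  @EtaleGroupoid Omega germ germ_src germ_rng germ_id germ_mul germ_inv
    germ_src_id germ_rng_id germ_src_mul germ_rng_mul germ_mulA germ_mulg1
    germ_mul1g germ_src_inv germ_rng_inv germ_mulgV germ_mulVg
    germ_src_continuous germ_rng_continuous germ_id_continuous
    germ_inv_continuous germ_mul_continuous germ_src_etale.

(* The classes [u, chi] with u invertible and t(u) = d(u).                    *)
Definition endo_germs : set germ :=
  [set g | exists u : C, invertible_endos C u /\
     exists x : OmegaD (Il_lmul u), g = germ_mk x].

Lemma endo_germs_open : open endo_germs.
Proof.
have -> : endo_germs = \bigcup_(u in invertible_endos C)
    range (@germ_mk (Il_lmul u)).
  apply/seteqP; split=> g.
    by case=> u [iu [x ->]]; exists u => //; exists x.
  by case=> u iu [x _ <-]; exists u; split=> //; exists x.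
by apply: bigcup_open => u _; apply: germ_mk_open; exact: openT.
Qed.

Lemma invertible_identity v : identities C v -> invertible_endos C v.
Proof.
move=> vv; have tv : ctgt v = v by rewrite -vv ctgt_dom.
have v1 : ccomp v v = v by rewrite -{2}vv ccomp1.
by split; [exists v; split; rewrite ?vv ?tv | rewrite tv vv].
Qed.

Lemma hull_dom_tgt (s : pbij C) : left_inverse_hull s ->
  exists v w : C, forall a b, s a b -> ctgt a = v /\ ctgt b = w.
Proof.
elim=> [c|{}s _ [v [w h]]|{}s t _ [v [w h]] _ [v' [w' k]]].
- by exists (cdom c), (ctgt c) => a b /= [ac ->]; rewrite ctgt_comp.
- by exists w, v => a b /= /h[].
- by exists v', w => a b /= [c /k[-> _] /h[_ ->]].
Qed.

Lemma endo_germs_id chi : endo_germs (germ_id chi).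
Proof.
have [e ce] := Omega_ex chi; have [s sI se] := JP e.
have [v0 [w0 h]] := hull_dom_tgt sI.
have [a ea] : exists a, J_set e a.
  apply: contrapT => ne; have := @Omega0 chi e; rewrite ce => H.
  by discriminate H; apply/seteqP; split=> a // ea; apply: ne; exists a.
have tv b : J_set e b -> ctgt b = ctgt a.
  by rewrite -se => -[c /h[-> _]]; move: ea; rewrite -se => -[d /h[-> _]].
have hv : Omega_dom (Il_lmul (ctgt a)) chi.
  move: ce; apply: Omega_le => b /tv eb; exists (ccomp (ctgt a) b) => /=.
  by rewrite eb cdom_tgt.
exists (ctgt a); split; first by apply: invertible_identity; exact: cdom_tgt.
exists (OmegaD_of hv); rewrite -germ_idE//.
by move=> b c /= [+ ->]; rewrite cdom_tgt => <-; rewrite ccomp1l.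
Qed.

Lemma invertible_endosV (u : C) : invertible_endos C u ->
  exists2 u' : C, invertible_endos C u' & lmul u' = pinv (lmul u).
Proof.
case=> -[w [uw wu uw1 wu1]] tu; exists w.
  by split; [exists u; split | rewrite -uw wu].
apply: pbij_eq => a b /=; split=> -[ab ->].
  rewrite ctgt_comp// -uw; split=> //.
  by rewrite ccompA// uw1 -wu -ab ccomp1l.
rewrite ctgt_comp// wu; split=> //.
by rewrite ccompA// wu1 -uw -ab ccomp1l.
Qed.

Lemma invertible_endosM (u w : C) : invertible_endos C u -> invertible_endos C w ->
  cdom u = ctgt w ->
  invertible_endos C (ccomp u w) /\ lmul (ccomp u w) = pcomp (lmul u) (lmul w).
Proof.
move=> [[u' [uu1 uu2 uu3 uu4]] tu] [[w' [ww1 ww2 ww3 ww4]] tw] uw; split.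
  split; last by rewrite ctgt_comp// cdom_comp// tu uw tw.
  have wu' : cdom w' = ctgt u' by rewrite ww2 -uw uu1.
  have uww' : cdom (ccomp u w) = ctgt w' by rewrite cdom_comp.
  exists (ccomp w' u'); split.
  - by rewrite cdom_comp// ctgt_comp.
  - by rewrite cdom_comp// ctgt_comp.
  - rewrite ctgt_comp// -ccompA ?ctgt_comp// (ccompA ww1 wu').
    by rewrite ww3 -uw uu1 ccomp1l uu3.
  - rewrite ctgt_comp// -ccompA ?ctgt_comp// (ccompA uu2 uw).
    by rewrite uu4 -uu1 uw ccomp1l ww4.
apply: pbij_eq => a b /=; split.
  rewrite cdom_comp// => -[aw ->]; exists (ccomp w a) => //.
  by rewrite ctgt_comp// ccompA.
by case=> c [aw ->] [_ ->]; rewrite cdom_comp// ccompA.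
Qed.

Lemma endo_germs_inv g : endo_germs g -> endo_germs (germ_inv g).
Proof.
case=> u [iu [x ->]]; have [w iw uw] := invertible_endosV iu.
rewrite germ_invE; have h : Omega_dom (Il_lmul w) (Omega_act x).
  have := Omega_act_dom x; apply: Omega_le => a [b ab].
  by exists b; rewrite (_ : Il_pbij (Il_lmul w) = pinv (lmul u))//; exact: ab.
exists w; split=> //; exists (OmegaD_of h).
apply: (@germ_mk_eqJ _ _ _ _ (J_dom (Il_lmul w))) => //.
by move=> a b _; rewrite (_ : Il_pbij (Il_lmul w) = pinv (lmul u)).
Qed.

Lemma endo_germs_mul g h : endo_germs g -> endo_germs h ->
  germ_src g = germ_rng h -> endo_germs (germ_mul g h).
Proof.
case=> u [iu [x ->]] [w [iw [y ->]]]; rewrite germ_srcE germ_rngE => xy.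
rewrite germ_mulE; have d := Omega_comp_dom xy.
have uw : cdom u = ctgt w.
  apply: contrapT => n; have := @Omega0 (OmegaD_val y)
    (J_dom (Il_comp (Il_lmul u) (Il_lmul w))); rewrite d => H; discriminate H.
  apply/seteqP; split=> a //= [b [c [ca ->] [+ _]]]; rewrite ctgt_comp// => wu.
  by apply: n.
have [iuw E] := invertible_endosM iu iw uw.
have uwy : Omega_dom (Il_lmul (ccomp u w)) (OmegaD_val y).
  by move: d; apply: Omega_le => a [b ab]; exists b;
    rewrite (_ : Il_pbij (Il_lmul (ccomp u w)) = pcomp (lmul u) (lmul w)).
exists (ccomp u w); split=> //; exists (OmegaD_of uwy).
apply: (@germ_mk_eqJ _ _ _ _ (J_dom (Il_lmul (ccomp u w)))) => //.
by move=> a b _;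
  rewrite (_ : Il_pbij (Il_lmul (ccomp u w)) = pcomp (lmul u) (lmul w)).
Qed.

Definition endo_groupoid : etaleGroupoid :=
  @open_subgroupoid hull_groupoid endo_germs endo_germs_open endo_germs_id
    endo_germs_mul endo_germs_inv.

End Hull.

(* Main.v *)
(** Everything is read off the principal characters [chi_z : e |-> (z \in e)]
    of Omega, which are dense and satisfy s.chi_z = chi_{s(z)}; moreover
    chi_z = chi_w iff w \in z C^*.  Hence [s, chi] is interior to the isotropy
    iff s(z) \in z C^* for all z in some eps with chi(eps) = 1, and [s, chi_x]
    is a unit iff s(x) = x.  Elements of I_l commute with right multiplication,
    so if s(x) = xu then s(xy) = xuy, and the condition on s over eps becomes
    the condition of (iii) on u over x^-1(eps), which contains the identity
    d(x). *)
Require Import Defs.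
From mathcomp Require Import all_boot.
From mathcomp Require Import all_classical topology.

Local Open Scope classical_set_scope.

(** * Effectiveness of étale groupoids and of their open subgroupoids *)

Lemma range_gid_open (G : etaleGroupoid) : open (range (@gid G)).
Proof.
rewrite openE => _ [x _ <-].
have [U [oU Ux Uinj _]] := @gsrc_etale G (gid x).
have nU : nbhs (gid x) U by exact: open_nbhs_nbhs.
have nV : nbhs (gid x) ((@gid G \o @gsrc G) @^-1` U).
  apply: (@continuous_comp _ _ _ (@gsrc G) (@gid G)).
  - exact: gsrc_continuous.
  - exact: gid_continuous.
  - by rewrite /= gsrc_id.
(* For [g] near [gid x], both [g] and the unit at its source lie in [U], where the source is
   injective, so they coincide. *)
apply: filterS2 nU nV => g Ug /= Vg; exists (gsrc g) => //.
by apply: Uinj => //; rewrite gsrc_id.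
Qed.

Lemma effectiveP (G : etaleGroupoid) :
  effective G <-> (@isotropy G)° `<=` range (@gid G).
Proof.
split=> [-> //|sub]; apply/seteqP; split=> //.
rewrite -open_subsetE; last exact: range_gid_open.
by move=> _ [x _ <-]; rewrite /isotropy /= gsrc_id grng_id.
Qed.

Lemma open_subgroupoid_effectiveP (G : etaleGroupoid) (H : set (garr G)) (oH : open H)
    (H1 : forall x, H (gid x))
    (HM : forall g h, H g -> H h -> gsrc g = grng h -> H (gmul g h))
    (HV : forall g, H g -> H (ginv g)) :
  effective (open_subgroupoid oH H1 HM HV) <->
  (@isotropy G)° `&` H `<=` range (@gid G).
Proof.
pose K := open_subgroupoid oH H1 HM HV.
(* As [H] is open, traces on [H] of open sets of arrows are open in [G], so interiors may be
   computed in [G]. *)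
have iE : (@isotropy K)° = (@set_val _ H) @^-1` (@isotropy G)°.
  apply/seteqP; split=> g.
    rewrite /interior /= nbhsE => -[_ [[O oO <-] Og] OI].
    exists (O `&` H); last first.
      by move=> h [Oh Hh]; exact: (OI (SigSub (mem_set Hh))).
    split; first exact: openI.
    by split=> //; exact: set_mem (valP g).
  by move=> Ig; exact: (@set_val_continuous (garr G) H g (@isotropy G) Ig).
rewrite effectiveP -/K iE; split=> sub g.
  case=> Ig Hg; have [//|x _ xg] := sub (SigSub (mem_set Hg)).
  by exists x => //; exact: (congr1 (@set_val _ H) xg).
move=> Ig; have [|x _ xg] := sub (set_val g).
  by split=> //; exact: set_mem (valP g).
by exists x => //; exact: val_inj.
Qed.

Section Hull.
Context {C : lcCategory}.
Implicit Types (a b c u v x y z : C) (e : J C) (s : Il C).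

(** * Right multiplication, the hull and its ideals *)

Lemma invertibleV u : invertibles C u ->
  exists2 w, invertibles C w & is_inverse u w.
Proof. by case=> w [uw wu u1 w1]; exists w => //; exists u. Qed.

(** For generators this is associativity, and it survives inverses and composites. *)
Lemma hull_equivariant (s : pbij C) a b : left_inverse_hull s -> s a b ->
  cdom a = cdom b /\
  forall c, ctgt c = cdom a -> s (ccomp a c) (ccomp b c).
Proof.
move=> hs; elim: hs a b => [d|t _ IH|t r _ IHt _ IHr] a b /=.
- case=> ad ->; rewrite cdom_comp//; split=> // c ca.
  by rewrite ctgt_comp// ccompA.
- by move=> /IH[ab h]; split=> // c ca; apply: h; rewrite ab.
- case=> m /IHr[am hr] /IHt[mb ht]; split; first by rewrite am.
  by move=> c ca; exists (ccomp m c); [exact: hr | apply: ht; rewrite -am].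
Qed.

Lemma J_ideal e a c : J_set e a -> ctgt c = cdom a -> J_set e (ccomp a c).
Proof.
have [s hs <-] := JP e => -[b sab] ca.
by exists (ccomp b c); have [_] := hull_equivariant _ _ _ hs sab; apply.
Qed.

(** Members of [J] are right ideals, and [b = au] can be undone by the inverse of [u]. *)
Lemma J_invertible e a b : lmulset a (invertibles C) b ->
  J_set e a <-> J_set e b.
Proof.
case=> u [/invertibleV[w _ [uw wu u1 w1]] ua ->]; split=> h.
  exact: J_ideal.
rewrite -(ccomp1 a) -ua -u1 ccompA//.
by apply: J_ideal => //; rewrite cdom_comp.
Qed.

(** * Principal characters and their density *)

Lemma principal_subproof a :
  Omega_set ((fun e => `[< J_set e a >]) : J_maps C).
Proof.
split; first split.
- exists (J_dom (Il_lmul (ctgt a))); apply/asboolP; exists a => /=.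
  by rewrite cdom_tgt ccomp1l.
- by move=> e f; apply/asboolP/andP => [[? ?]|[/asboolP ? /asboolP ?]];
    split=> //; exact/asboolP.
- by move=> e e0; apply/asboolP; rewrite e0.
- move=> e n f -> /asboolP[i _ fia]; exists i; exact/asboolP.
Qed.

Definition principal a : Omega C := Omega_of (principal_subproof a).

Lemma principalP a e : principal a e = true <-> J_set e a.
Proof. by split=> [/asboolP //|h]; apply/asboolP. Qed.

Lemma principal_barP a eps : Jbar eps -> Omega_bar (principal a) eps <-> eps a.
Proof.
case=> e [n [f [fe ->]]]; rewrite Omega_barP//; split.
  case=> /principalP ea nf; split=> // -[i _ fa].
  by have := nf i; rewrite (principalP a (f i)).2.
case=> ea nf; split; first exact/principalP.
by move=> i; apply/negP => /principalP fa; apply: nf; exists i.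
Qed.

(** Testing on aC and bC, the domains of the inverses of [lmul a] and [lmul b], gives [b = au] and
    [a = bw]; left cancellation makes [u] and [w] mutually inverse. *)
Lemma principal_inj a b : principal a = principal b ->
  lmulset a (invertibles C) b.
Proof.
have refl c : J_set (J_dom (Il_inv (Il_lmul c))) c.
  by exists (cdom c) => /=; rewrite ctgt_dom ccomp1.
move=> ab.
have [w /= [wb aE]] : J_set (J_dom (Il_inv (Il_lmul b))) a.
  by apply/principalP; rewrite ab; exact/principalP.
have [u /= [ua bE]] : J_set (J_dom (Il_inv (Il_lmul a))) b.
  by apply/principalP; rewrite -ab; exact/principalP.
have du : cdom u = ctgt w by rewrite wb bE cdom_comp.
have dw : cdom w = ctgt u by rewrite ua aE cdom_comp.
exists u; split=> //; exists w; split=> //.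
  apply: (@lc_cancel C a); rewrite ?ctgt_comp// ?ctgt_tgt//.
  by rewrite ccompA// -bE -aE ua ccomp1.
apply: (@lc_cancel C b); rewrite ?ctgt_comp// ?ctgt_tgt//.
by rewrite ccompA// -aE -bE wb ccomp1.
Qed.

Lemma Omega_act_principal s (x : OmegaD s) a b :
  OmegaD_val x = principal a -> s a b -> Omega_act x = principal b.
Proof.
move=> xa sab; apply: Omega_eq => e; rewrite Omega_actE xa.
apply/idP/idP => /principalP h; apply/principalP.
  by case: h => d sad ed; rewrite (pgraph_fun sab sad).
by exists b.
Qed.

Lemma Omega_bar_decides (chi : Omega C) e : exists2 eps, Omega_bar chi eps &
  forall z, eps z -> principal z e = chi e.
Proof.
case chiE : (chi e).
  by exists (J_set e); [exact: Omega_barE | move=> z /principalP].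
have [d cd] := Omega_ex chi.
have le (i : 'I_1) : J_set (J_meet d e) `<=` J_set d by move=> a [].
(* When chi(e) = 0, remove [e] from any [d] with chi(d) = 1; the meet with [d] keeps the removed set
   inside [d]. *)
exists (J_set d `\` \bigcup_(i : 'I_1) J_set (J_meet d e)).
  by apply/(Omega_barP _ le); rewrite OmegaI cd chiE.
move=> z [dz ndez]; apply/negP => /principalP ez.
by apply: ndez; exists ord0.
Qed.

(** The sets [eps] with chi(eps) = 1 generate a filter along which the characters [principal z]
    converge pointwise to [chi], because each [e] is eventually decided. *)
Lemma nbhs_principal (chi : Omega C) (A : set (Omega C)) : nbhs chi A ->
  exists2 eps, Omega_bar chi eps & eps `<=` principal @^-1` A.
Proof.
pose F : set_system C := fun A => exists2 eps, Omega_bar chi eps & eps `<=` A.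
have FF : Filter F.
  split.
  - by have [e ce] := Omega_ex chi; exists (J_set e); first exact: Omega_barE.
  - move=> P Q [e ce eP] [d cd dQ]; exists (e `&` d); first exact: Omega_barI.
    exact: setISS.
  - by move=> P Q PQ [e ce eP]; exists e => // z /eP /PQ.
have Fchi : (set_val \o principal : C -> J_maps C) @ F -->
    (set_val chi : J_maps C).
  apply/cvg_sup => e B; rewrite nbhsE => -[_ [[O oO <-] Oc] OB].
  have [eps ceps dec] := Omega_bar_decides chi e.
  exists eps => // z /dec ze; apply: OB => /=.
  by move: Oc; rewrite /= -[set_val chi e]/(chi e) -ze.
rewrite nbhsE => -[_ [[O oO <-] Oc] OA].
have [eps ceps epsO] : F ((set_val \o principal) @^-1` O).
  by apply: Fchi; exact: open_nbhs_nbhs.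
by exists eps => // z /epsO /OA.
Qed.

(** * Interior isotropy and units, tested on points of the category *)

Definition almost_fixes (s : pbij C) (eps : set C) :=
  forall z w, eps z -> s z w -> lmulset z (invertibles C) w.

Lemma interior_isotropyP s (x : OmegaD s) :
  (@isotropy (hull_groupoid C))° (germ_mk x) <->
  exists2 eps, Omega_bar (OmegaD_val x) eps & almost_fixes s eps.
Proof.
split.
  move=> /germ_mk_continuous; rewrite nbhsE => -[_ [[O oO <-] Ox] OI].
  have [eps xeps epsO] := nbhs_principal _ _ (open_nbhs_nbhs (conj oO Ox)).
  exists eps => // z w epsz szw.
  have h : Omega_dom s (principal z) by apply/principalP; exists w.
  have /= := OI (OmegaD_of h) (epsO _ epsz).
  rewrite /isotropy /= germ_srcE germ_rngE OmegaD_ofK => zE.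
  by apply: principal_inj; rewrite zE; exact: Omega_act_principal szw.
case=> eps xeps fix_eps.
pose N : set (OmegaD s) := @OmegaD_val C s @^-1` [set chi | Omega_bar chi eps].
apply: (@filterS _ (nbhs (germ_mk x)) _ (@germ_mk C s @` N)); last first.
  apply: open_nbhs_nbhs; split; last by exists x.
  apply: germ_mk_open; move/continuousP: (@OmegaD_val_continuous C s); apply.
  exact: Omega_bar_open.
move=> _ [y yeps <-]; rewrite /isotropy /= germ_srcE germ_rngE.
(* By [Omega_barS] it suffices to compare [e] with its preimage under [s] on the points of [eps],
   where [z] and [s(z)] lie in the same members of [J]. *)
apply: Omega_eq => e; rewrite Omega_actE; apply/idP/idP => ye.
  apply: (Omega_barS (Omega_barI yeps
    (Omega_barI (Omega_barE ye) (Omega_barE (OmegaDP y))))).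
  move=> z [epsz [ez [w szw]]]; exists w => //.
  by apply/(J_invertible _ z); first exact: fix_eps szw.
apply: (Omega_barS (Omega_barI yeps (Omega_barE ye))).
by move=> z [epsz [w szw ew]]; apply/(J_invertible _ z w); first exact: fix_eps.
Qed.

Lemma germ_unitP s (x : OmegaD s) :
  range (@germ_id C) (germ_mk x) <->
  exists2 eps, Omega_bar (OmegaD_val x) eps &
    forall z w, eps z -> s z w -> w = z.
Proof.
split.
  case=> chi _; rewrite /germ_id => /germ_mk_eq[].
  rewrite OmegaD_ofK => -> [eps [_ xeps E]]; exists eps => // z w ez szw.
  have : prestrict s eps z w by [].
  by rewrite -E => -[_ /Il_idemE[]].
case=> eps xeps s1; exists (OmegaD_val x) => //.
(* The unit is represented by the idempotent on the domain of [s], so that it agrees with [s] on all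
   of [eps]. *)
rewrite (@germ_idE _ _ (OmegaD_of (Omega_dom_idem (OmegaDP x)))).
  apply/germ_mk_eq; rewrite OmegaD_ofK; split=> //.
  exists eps; split=> //; first exact: Omega_bar_Jbar xeps.
  apply: pbij_eq => a b; split=> -[ea ab]; split=> //.
    by case/Il_idemE: ab => -[c sac] <-; rewrite -{2}(s1 _ _ ea sac).
  by apply/Il_idemE; split; [exists b | rewrite (s1 _ _ ea ab)].
by move=> a b /Il_idemE[].
Qed.

Lemma lmulset_identity v x : identities C v ->
  lmulset v setT x <-> ctgt x = v.
Proof.
move=> vv; split=> [[y [_ yv ->]]|xv].
  by rewrite ctgt_comp// -vv ctgt_dom.
by exists x; split=> //; rewrite -xv ?cdom_tgt// ccomp1l.
Qed.

End Hull.

Theorem theorem4p5 (C : lcCategory) :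
  (effective (hull_groupoid C) <-> effective (endo_groupoid C)) /\
  (effective (endo_groupoid C) <->
   (forall (v u : C) (n : nat) (f : 'I_n -> J C),
      identities C v -> invertibles_at C v u ->
      (forall i, J_set (f i) `<` lmulset v setT) ->
      (forall z : C, (lmulset v setT `\` \bigcup_i J_set (f i)) z ->
         lmulset z (invertibles C) (ccomp u z)) ->
      forall x : C, (lmulset v setT `\` \bigcup_i J_set (f i)) x ->
        ccomp u x = x)).
Proof.
set iii := (X in _ /\ (_ <-> X)).
have hull_endo : effective (hull_groupoid C) -> effective (endo_groupoid C).
  by move/effectiveP => sub; apply/open_subgroupoid_effectiveP => g [/sub].
have endo_iii : effective (endo_groupoid C) -> iii.
  move/open_subgroupoid_effectiveP => sub v u n f vv [iu tu du] fv fix_u x epsx.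
  (* Being a domain, vC is constructible, so the difference in (iii) belongs to [Jbar]. *)
  have vE : lmulset v setT = J_set (J_dom (Il_lmul u)).
    apply/seteqP; split=> a.
      by move/(lmulset_identity _ _ vv) => av; exists (ccomp u a); rewrite /= av du.
    by case=> b [ab _]; apply/(lmulset_identity _ _ vv); rewrite ab.
  move: fv fix_u epsx; rewrite vE => fv fix_u epsx.
  have xeps : Omega_bar (principal x)
      (J_set (J_dom (Il_lmul u)) `\` \bigcup_i J_set (f i)).
    apply/principal_barP => //; exists (J_dom (Il_lmul u)), n, f; split=> //.
    by move=> i; case: (fv i).
  have h : Omega_dom (Il_lmul u) (principal x).
    by apply/principalP; case: epsx.
  have /germ_unitP[eps /= + u1] :
      range (@germ_id C) (germ_mk (OmegaD_of h)).
    apply: sub; split; last first.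
      by exists u; split; [split; rewrite // tu | exists (OmegaD_of h)].
    apply/interior_isotropyP; eexists; first exact: xeps.
    by move=> z w epsz [_ ->]; exact: fix_u.
  move=> eps1; apply: u1.
    by apply/principal_barP => //; exact: Omega_bar_Jbar eps1.
  by case: epsx => -[b [ub _]] _.
have iii_hull : iii -> effective (hull_groupoid C).
  move=> fix3; apply/effectiveP; elim/germ_mkP => s x.
  case/interior_isotropyP => eps xeps fix_eps; apply/germ_unitP.
  exists eps => // z w epsz szw.
  have [e [n [f [fe epsE _ _]]]] := xeps.
  have [u [iu uz wE]] := fix_eps z w epsz szw.
  have [zw equiv] := hull_equivariant _ _ _ (IlP s) szw.
  have du : cdom u = cdom z by rewrite zw wE cdom_comp.
  have vv : identities C (cdom z) by exact: cdom_dom.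
  have u1 : ccomp u (cdom z) = cdom z.
    (* Pull [eps] back along multiplication by [z]. Only the [f i] need pulling back: [e] contains
       all of zC. *)
    apply: (fix3 (cdom z) u n (fun i => J_preimage (Il_lmul z) (f i))) => //.
    - move=> i; split.
        by move=> y [_ [yz _] _]; apply/(lmulset_identity _ _ vv).
      (* Properness is witnessed by the identity [cdom z]: its image [z] lies in [eps], hence in no
         [f i]. *)
      move/(_ (cdom z)); case; first by apply/(lmulset_identity _ _ vv); exact: ctgt_dom.
      move=> _ [_ ->]; rewrite ccomp1 => fz.
      by move: epsz; rewrite epsE => -[_]; apply; exists i.
    - move=> y [/(lmulset_identity _ _ vv) yz nf].
      have epszy : eps (ccomp z y).
        move: epsz; rewrite epsE => -[ez _]; split; first exact: J_ideal.
        by case=> i _ fzy; apply: nf; exists i => //; exists (ccomp z y).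
      have [a [ia az E]] := fix_eps _ _ epszy (equiv y yz).
      have ya : cdom y = ctgt a by rewrite az cdom_comp.
      exists a; split=> //.
      (* By equivariance s(zy) = zuy, and this equals zya with [a] invertible; cancelling [z] leaves
         uy = ya. *)
      apply: (@lc_cancel C z); rewrite ?ctgt_comp// ?du//.
      by rewrite !ccompA ?du// -wE.
    - split; first by apply/(lmulset_identity _ _ vv); exact: ctgt_dom.
      case=> i _ [_ [_ ->]]; rewrite ccomp1 => fz.
      by move: epsz; rewrite epsE => -[_]; apply; exists i.
  by rewrite wE -[u]ccomp1 du u1 ccomp1.
by split; split=> // h; [apply/iii_hull/endo_iii | apply/hull_endo/iii_hull].
Qed.
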